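(* For every positive real number $t$ there exists a lattice polytope whose Ehrhart polynomial has a real root strictly larger than $t$. More precisely, for every positive integer $d$ there is a $d$-dimensional $0/1$-polytope $P_d$ whose Ehrhart polynomial has a real zero $\alpha_d$ such that $\lim_{d\to\infty}\alpha_d/d=1/(2\pi e)$.
   Context: A lattice polytope is a convex polytope whose vertices have integer coordinates; a $0/1$-polytope is one whose vertices all have coordinates in $\{0,1\}$. The Ehrhart polynomial $i_P$ of a lattice polytope $P\subset\mathbb{R}^N$ is the polynomial satisfying $i_P(n)=\#(nP\cap\mathbb{Z}^N)$ for all nonnegative integers $n$. *)

(* Defs.v *)
From HB Require Import structures.
From mathcomp Require Import all_boot all_order all_algebra.
From mathcomp Require Import archimedean vector.
From mathcomp Require Import all_classical all_reals all_analysis.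

Set Implicit Arguments.
Unset Strict Implicit.
Unset Printing Implicit Defensive.

Import Order.TTheory GRing.Theory Num.Theory.
Import numFieldNormedType.Exports.

Local Open Scope classical_set_scope.
Local Open Scope card_scope.
Local Open Scope ring_scope.

Definition conv_hull (R : realType) (N : nat) (A : set 'rV[R]_N) :
    set 'rV[R]_N :=
  [set x | exists (k : nat) (a : 'I_k -> R) (v : 'I_k -> 'rV[R]_N),
    [/\ forall i, 0 <= a i, \sum_(i < k) a i = 1, forall i, A (v i)
      & x = \sum_(i < k) a i *: v i]].

Definition affine_hull (R : realType) (N : nat) (A : set 'rV[R]_N) :
    set 'rV[R]_N :=
  [set x | exists (k : nat) (a : 'I_k -> R) (v : 'I_k -> 'rV[R]_N),
    [/\ \sum_(i < k) a i = 1, forall i, A (v i)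
      & x = \sum_(i < k) a i *: v i]].

(* Polytopes are nonempty; otherwise the zero polynomial would be the Ehrhart
   polynomial of the empty polytope. *)
Definition is_polytope (R : realType) (N : nat) (P : set 'rV[R]_N) : Prop :=
  exists V : set 'rV[R]_N, [/\ finite_set V, V !=set0 & P = conv_hull V].

Definition vertices (R : realType) (N : nat) (P : set 'rV[R]_N) :
    set 'rV[R]_N :=
  [set x | P x /\ forall (y z : 'rV[R]_N) (t : R), P y -> P z ->
    0 < t < 1 -> x = t *: y + (1 - t) *: z -> y = x /\ z = x].

Definition int_points (R : realType) (N : nat) : set 'rV[R]_N :=
  [set x | forall j, x 0 j \is a Num.int].

Definition is_lattice_polytope (R : realType) (N : nat) (P : set 'rV[R]_N) :
    Prop :=
  is_polytope P /\ vertices P `<=` int_points (R := R) (N := N).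

Definition is_01_polytope (R : realType) (N : nat) (P : set 'rV[R]_N) : Prop :=
  is_polytope P /\
  vertices P `<=` [set x : 'rV[R]_N | forall j, x 0 j = 0 \/ x 0 j = 1].

Definition has_dim (R : realType) (N : nat) (P : set 'rV[R]_N) (d : nat) :
    Prop :=
  exists (x0 : 'rV[R]_N) (U : {vspace 'rV[R]_N}),
    \dim U = d /\ affine_hull P = [set x0 + u | u in [set u | u \in U]].

Definition dilate (R : realType) (N : nat) (n : nat) (P : set 'rV[R]_N) :
    set 'rV[R]_N :=
  [set n%:R *: x | x in P].

(* A polynomial satisfying this is unique, being determined on all of nat. *)
Definition is_ehrhart_poly (R : realType) (N : nat) (P : set 'rV[R]_N)
    (p : {poly R}) : Prop :=
  forall n : nat, exists k : nat,
    (dilate n P `&` int_points (R := R) (N := N)) #= `I_k /\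
    p.[n%:R] = k%:R.

(* Main.v *)
(** The polytope is a pyramid over an [m]-cube with [m] even, times a segment
    when [d] is even.  Its Ehrhart polynomial is [S(n + 2)] (times [n + 1]),
    where [S(x + 1) - S(x) = x^m] and [S(0) = 0], so that [S] is a Bernoulli
    polynomial up to scaling.  Put [D = m + 1].  Pairing [S] with [sin (2 pi x)]
    on [0, 1] isolates one Fourier coefficient of [S], of absolute value
    [m! / (2 pi)^D]; together with [S(1 - x) = - S(x)] this yields [x0] in
    [0, 1] with [S(x0) <= - m! / (2 pi)^D].  As [S(x0 + k) - S(x0)] is at most
    [(x0 + k)^D / D] and [D! >= (D / e)^D], [S(x0 + k)] is still nonpositive as
    long as [x0 + k <= D / (2 pi e)], whereas [S(k + 1) >= 0].  Hence [S] has a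
    zero at bounded distance from [D / (2 pi e)]. *)

Require Import Defs.
From HB Require Import structures.
From mathcomp Require Import all_boot all_order all_algebra.
From mathcomp Require Import archimedean vector.
From mathcomp Require Import all_classical all_reals all_analysis.
From mathcomp Require Import ring lra zify.

Import Order.TTheory GRing.Theory Num.Theory.
Import numFieldNormedType.Exports.

Local Open Scope classical_set_scope.
Local Open Scope ring_scope.

(** * Polynomials summing powers *)

(** The forward difference of ['X^(m.+1)] is [m.+1%:R *: 'X^m] plus binomial multiples of lower
    powers, which the polynomials of the induction hypothesis cancel. *)
Lemma power_sum_poly_exists (R : realType) (m : nat) :
  exists S : {poly R}, S \Po ('X + 1) - S = 'X^m /\ S.[0] = 0.
Proof.
elim/ltn_ind: m => m IH.
have /choice[S HS] : forall i, exists S : {poly R},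
    (i < m)%N -> S \Po ('X + 1) - S = 'X^i /\ S.[0] = 0.
  move=> i; case: (ltnP i m) => [/IH[S HS]|_]; first by exists S.
  by exists 0.
have m1_neq0 : m.+1%:R != 0 :> R by rewrite pnatr_eq0.
exists (m.+1%:R^-1 *: ('X^(m.+1) - \sum_(i < m) S i *+ 'C(m.+1, i))); split.
  have sumS : (\sum_(i < m) S i *+ 'C(m.+1, i)) \Po ('X + 1) =
      \sum_(i < m) S i *+ 'C(m.+1, i) + \sum_(i < m) 'X^i *+ 'C(m.+1, i).
    rewrite raddf_sum -big_split /=; apply: eq_bigr => i _.
    by rewrite raddfMn /= -mulrnDl -(HS i (ltn_ord i)).1 addrC subrK.
  rewrite comp_polyZ comp_polyB sumS -scalerBr.
  rewrite -[RHS]scale1r -[X in _ = X *: _](mulVf m1_neq0) -scalerA.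
  congr (_ *: _).
  rewrite comp_Xn_poly (addrC 'X 1) exprDn.
  under eq_bigr do rewrite expr1n mul1r.
  rewrite !big_ord_recr /= binn mulr1n binSn scaler_nat.
  ring.
rewrite hornerZ hornerD hornerN hornerXn expr0n /= horner_sum big1 ?subrr ?mulr0//.
by move=> i _; rewrite hornerMn (HS i (ltn_ord i)).2 mul0rn.
Qed.

Lemma poly_eq_nat (R : realType) (p q : {poly R}) :
  (forall n : nat, p.[n%:R] = q.[n%:R]) -> p = q.
Proof.
move=> pq; apply/eqP; rewrite -subr_eq0; apply/eqP.
apply: (@roots_geq_poly_eq0 _ _ [seq i%:R | i <- iota 0 (size (p - q))]).
- by apply/allP => _ /mapP[i _ ->]; rewrite /root hornerD hornerN pq subrr.
- rewrite map_inj_uniq ?iota_uniq// => i j /eqP.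
  by rewrite eqr_nat => /eqP.
- by rewrite size_map size_iota.
Qed.

(** * A Fourier coefficient of [S] and its dip below zero *)

Lemma derivn_comp_XD1 (R : realType) (p : {poly R}) (n : nat) :
  (p \Po ('X + 1))^`(n) = p^`(n) \Po ('X + 1).
Proof.
elim: n => [|n IH]; first by rewrite !derivn0.
by rewrite !derivnS IH deriv_comp derivD derivX derivC addr0 mulr1.
Qed.

(* [A cos (w x) + B sin (w x)] with [B = - A' / w] is an antiderivative of
   [- (w A + A'' / w) sin (w x)]. *)
Lemma is_derive_sin_antiderivative (R : realType) (w : R) (A : {poly R}) x :
  w != 0 ->
  is_derive x (1 : R)
    (fun y => A.[y] * cos (w * y) - w^-1 * A^`().[y] * sin (w * y))
    (- (w * A.[x] + w^-1 * A^`()^`().[x]) * sin (w * x)).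
Proof.
move=> w0.
have dw : is_derive x (1 : R) (fun y : R => w * y) w.
  have -> : (fun y : R => w * y) = horner (w *: 'X).
    by apply/funext => y; rewrite hornerZ hornerX.
  by apply: (is_derive_eq (is_derive_poly _ _)); rewrite derivZ derivX hornerZ hornerC mulr1.
have dcos := is_derive1_comp (is_derive_cos (w * x)) dw.
have dsin := is_derive1_comp (is_derive_sin (w * x)) dw.
have dA := is_deriveM (is_derive_poly A x) dcos.
have dB := is_deriveM (is_derive_poly (w^-1 *: A^`()) x) dsin.
have := is_deriveB dA dB.
rewrite (_ : _ - _ = fun y => A.[y] * cos (w * y) - w^-1 * A^`().[y] * sin (w * y)); last first.
  by apply/funext => y /=; rewrite /= !fctE /= hornerZ.
move=> dF; apply: (is_derive_eq dF).
rewrite /= derivZ !hornerZ /GRing.scale /=.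
by field.
Qed.

(** [A] comes from the Neumann series inverting the operator [w + w^-1 D^2], with [D] the
    derivation; the series is finite because [S] is a polynomial. In [A.[1] - A.[0]] each term is an
    even derivative of ['X^(M.*2)] at 0, so only the one of order [M.*2] survives. *)
Lemma exists_sin_antiderivative (R : realType) (w : R) (S : {poly R}) (M : nat) :
  w != 0 -> S \Po ('X + 1) - S = 'X^(M.*2) ->
  exists A : {poly R}, [/\ forall x, - (w * A.[x] + w^-1 * A^`()^`().[x]) = S.[x]
    & A.[1] - A.[0] = - w^-1 * (- w ^- 2) ^+ M * (M.*2)`!%:R].
Proof.
move=> w0 HS.
pose K := (size S + M).+1; pose q := - w ^- 2.
pose A := - w^-1 *: \sum_(i < K) q ^+ i *: S^`(i.*2).
have dS n : S^`(n).[1] - S^`(n).[0] = 'X^(M.*2)^`(n).[0].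
  rewrite -HS derivnB derivn_comp_XD1 hornerD hornerN horner_comp.
  by rewrite hornerD hornerX hornerC add0r.
exists A; split.
  move=> x; pose u i := q ^+ i *: S^`(i.*2).
  have -> : S = u 0%N - u K.
    rewrite /u expr0 scale1r derivn0 derivn_poly0 ?scaler0 ?subr0// /K; lia.
  have -> : u 0%N - u K = - (w *: A + w^-1 *: A^`()^`()).
    rewrite -[LHS]opprB -telescope_sumr//; congr (- _).
    have -> : A^`()^`() = - w^-1 *: \sum_(i < K) q ^+ i *: S^`(i.+1.*2).
      rewrite /A !derivZ; congr (_ *: _).
      rewrite (raddf_sum (@deriv R)) /= (raddf_sum (@deriv R)) /=.
      by apply: eq_bigr => i _; rewrite !derivZ ?doubleS ?derivnS.
    rewrite big_mkord /A !scaler_sumr -big_split /=.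
    apply: eq_bigr => i _; rewrite /u !scalerA addrC.
    by rewrite -scaleNr; congr (_ *: _ + _ *: _); rewrite ?exprS /q; field.
  by rewrite hornerN hornerD !hornerZ.
rewrite /A !hornerZ -mulrBr -mulrA; congr (_ * _).
rewrite !horner_sum -sumrB.
have MK : (M < K)%N by rewrite /K; lia.
rewrite (bigD1 (Ordinal MK))//= big1 ?addr0.
  rewrite !hornerZ -mulrBr dS derivnXn subnn hornerMn hornerXn ffactnn.
  by rewrite expr0.
move=> i; rewrite -val_eqE /= => iM.
rewrite !hornerZ -mulrBr dS derivnXn hornerMn hornerXn expr0n subn_eq0.
case: leqP => Mi; last by rewrite mul0rn mulr0.
rewrite ffact_small ?mulr0//.
have := ltn_neqAle M i; lia.
Qed.

Lemma horner_addn_power_sum (R : realType) (S : {poly R}) (m k : nat) (x : R) :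
  S \Po ('X + 1) - S = 'X^m ->
  S.[x + k%:R] = S.[x] + \sum_(j < k) (x + j%:R) ^+ m.
Proof.
move=> HS; elim: k => [|k IH]; first by rewrite big_ord0 !addr0.
have : (S \Po ('X + 1) - S).[x + k%:R] = 'X^m.[x + k%:R] by rewrite HS.
rewrite hornerD hornerN horner_comp hornerD hornerX hornerC hornerXn => /eqP.
rewrite subr_eq -addrA natr1 => /eqP ->.
by rewrite big_ord_recr /= IH; ring.
Qed.

(** As the exponent is even, [- S.[1 - x]] solves the same difference equation as [S]; both vanish
    at 0, hence they agree on all naturals. *)
Lemma power_sum_reflect (R : realType) (S : {poly R}) (M : nat) (x : R) :
  (0 < M)%N -> S \Po ('X + 1) - S = 'X^(M.*2) -> S.[0] = 0 ->
  S.[1 - x] = - S.[x].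
Proof.
move=> M0 HS S0.
have step y : S.[y + 1] = S.[y] + y ^+ M.*2.
  by rewrite (horner_addn_power_sum _ _ _ 1 y HS) big_ord1 addr0.
suff E : - (S \Po (1 - 'X)) = S.
  rewrite -{2}E hornerN opprK horner_comp.
  by rewrite hornerD hornerN hornerX hornerC.
have TE y : (- (S \Po (1 - 'X))).[y] = - S.[1 - y].
  by rewrite hornerN horner_comp hornerD hornerN hornerX hornerC.
apply: poly_eq_nat; elim=> [|n IH]; rewrite TE.
  by rewrite subr0 -[1]add0r step S0 expr0n double_eq0 gtn_eqF// addr0 oppr0.
rewrite -natr1 step -IH TE.
have := step (- n%:R); rewrite -mul2n exprM sqrrN -exprM addrC => ->.
rewrite (_ : 1 - (n%:R + 1) = - n%:R); [ring|ring].
Qed.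

Lemma power_sum_dip (R : realType) (S : {poly R}) (M : nat) :
  (0 < M)%N -> S \Po ('X + 1) - S = 'X^(M.*2) -> S.[0] = 0 ->
  exists2 x, 0 <= x <= 1 & S.[x] <= - ((M.*2)`!%:R / (2 * pi) ^+ (M.*2).+1).
Proof.
move=> M0 HS S0; set w : R := 2 * pi.
have w_gt0 : 0 < w by rewrite mulr_gt0// pi_gt0.
have w0 : w != 0 by rewrite gt_eqF.
have [A [AS A01]] := exists_sin_antiderivative _ w S M w0 HS.
pose G y := A.[y] * cos (w * y) - w^-1 * A^`().[y] * sin (w * y).
have dG y : is_derive y (1 : R) G (S.[y] * sin (w * y)).
  by rewrite -AS; exact: is_derive_sin_antiderivative.
have cG : {within `[0, 1], continuous G}.
  by apply: derivable_within_continuous => y _; have [] := dG y.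
(* The mean value theorem replaces the integral of [S.[y] * sin (w * y)] over the unit interval by
   one value of the integrand. *)
have [z] := MVT_segment ler01 (fun y _ => dG y) cG.
rewrite in_itv /= subr0 mulr1 => z01.
have w2 : w = pi *+ 2 by rewrite /w mulr_natl.
rewrite /G !mulr1 !mulr0 w2 sin2pi cos2pi cos0 sin0 -w2 !mulr0 !subr0 !mulr1 A01.
set B := _ / _ => E.
have normE : `|S.[z]| * `|sin (w * z)| = B.
  rewrite -normrM -E !normrM normrX !normrN normrV ?unitfE//.
  rewrite normr_nat (ger0_norm (ltW (_ : 0 < w ^- 2))) ?invr_gt0 ?exprn_gt0//.
  rewrite (gtr0_norm w_gt0) /B -exprVn -exprM mul2n mulrC.
  by rewrite -exprS exprVn.
have BS : B <= `|S.[z]|.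
  by rewrite -normE ler_piMr// ler_norml sin_geN1 sin_le1.
(* If [S] is large and positive at [z], the reflected point [1 - z] gives the dip. *)
case: (lerP 0 S.[z]) => Sz.
  exists (1 - z); first by lra.
  by rewrite (power_sum_reflect _ _ M)// lerN2 -(ger0_norm Sz).
by exists z => //; rewrite lerNr -(ltr0_norm Sz).
Qed.

(** * Growth estimates and a zero near [D / (2 pi e)] *)

Lemma ler_exprS_tangent (R : realType) (y : R) (m : nat) : 0 <= y ->
  y ^+ m.+1 + m.+1%:R * y ^+ m <= (y + 1) ^+ m.+1.
Proof.
move=> y0; elim: m => [|m IH]; first by rewrite !expr1 expr0 mulr1.
rewrite [leRHS]exprS; apply: le_trans (ler_wpM2l _ IH); last by lra.
rewrite -subr_ge0 [X in 0 <= X](_ : _ = m.+1%:R * y ^+ m) ?mulr_ge0 ?exprn_ge0//.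
rewrite -[m.+2%:R]natr1 -[m.+1%:R]natr1 !exprS; ring.
Qed.

(** Discrete form of comparing the sum with the integral of [t ^+ m]; the tangent inequality gives
    the induction step. *)
Lemma sum_power_le (R : realType) (x : R) (m k : nat) : 0 <= x ->
  \sum_(j < k) (x + j%:R) ^+ m <= (x + k%:R) ^+ m.+1 / m.+1%:R.
Proof.
move=> x0; elim: k => [|k IH].
  by rewrite big_ord0 divr_ge0 ?exprn_ge0 ?addr0.
rewrite big_ord_recr /=; apply: le_trans (lerD IH (lexx _)) _.
rewrite ler_pdivlMr// mulrDl divfK ?pnatr_eq0// [X in _ + X]mulrC.
by rewrite -[k.+1%:R]natr1 addrA ler_exprS_tangent// addr_ge0.
Qed.

(** The exponential series at [n] dominates its term of index [n]. *)
Lemma expn_le_fact_expR (R : realType) (n : nat) :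
  (n%:R ^+ n : R) <= n`!%:R * expR 1 ^+ n.
Proof.
case: n => [|n]; first by rewrite !expr0 mulr1.
have := @expR_ge1Dxn R n.+1%:R n (ler0n _ _).
rewrite -expRM_natr mul1r => le_exp.
rewrite mulrC -ler_pdivrMr ?ltr0n ?fact_gt0//.
by apply: le_trans le_exp; rewrite lerDr.
Qed.

Lemma power_sum_root (R : realType) (S : {poly R}) (M : nat) (c : R) :
  (0 < M)%N -> S \Po ('X + 1) - S = 'X^(M.*2) -> S.[0] = 0 ->
  c = 1 / (2 * pi * expR 1) -> 1 <= c * (M.*2).+1%:R ->
  exists2 x, root S x & c * (M.*2).+1%:R - 2 <= x <= c * (M.*2).+1%:R.
Proof.
move=> M0 HS S0 cE; set D := (M.*2).+1 => cD.
have [x0 /andP[x0_ge0 x0_le1] Sx0] := power_sum_dip _ _ _ M0 HS S0.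
(* [k + 1] is the integer part of [c * D%:R], so [x0 + k%:R] is at most [c * D%:R], and [k%:R]
   exceeds [c * D%:R - 2]. *)
have [k [k1 k2]] : exists k : nat, k.+1%:R <= c * D%:R /\ c * D%:R < k.+2%:R.
  have /andP[] := @truncn_itv R (c * D%:R) (le_trans ler01 cD).
  case: (Num.trunc _) => [_|k]; last by exists k.
  by rewrite ltNge cD.
have w_gt0 : 0 < 2 * pi :> R by rewrite mulr_gt0// pi_gt0.
have Sk : S.[x0 + k%:R] <= 0.
  rewrite (horner_addn_power_sum _ _ _ _ _ HS).
  have le1 := sum_power_le _ x0 M.*2 k x0_ge0.
  have le2 : (x0 + k%:R) ^+ D / D%:R <= (M.*2)`!%:R / (2 * pi) ^+ D.
    rewrite ler_pdivrMr// mulrAC -natrM mulnC -factS -/D ler_pdivlMr ?exprn_gt0//.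
    apply: (@le_trans _ _ ((c * D%:R) ^+ D * (2 * pi) ^+ D)).
      rewrite ler_pM2r ?exprn_gt0// lerXn2r ?nnegrE ?addr_ge0//.
        exact: le_trans cD.
      by apply: le_trans k1; rewrite -natr1 addrC lerD2l.
    (* The value of [c] reduces the claim to [(D / e) ^ D <= D!]. *)
    rewrite -exprMn (_ : c * D%:R * (2 * pi) = D%:R / expR 1); last first.
      have e0 : expR 1 != 0 :> R by rewrite gt_eqF ?expR_gt0.
      have w0 : 2 * pi != 0 :> R by rewrite gt_eqF.
      by rewrite cE; move: (2 * pi) (expR 1) e0 w0 => w e e0 w0; field; apply/andP.
    by rewrite exprMn exprVn ler_pdivrMr ?exprn_gt0 ?expR_gt0// expn_le_fact_expR.
  by apply: le_trans (lerD Sx0 (le_trans le1 le2)) _; rewrite addNr.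
have Sk1 : 0 <= S.[k.+1%:R].
  rewrite -[k.+1%:R]add0r (horner_addn_power_sum _ _ _ _ _ HS) S0 add0r.
  by apply: sumr_ge0 => i _; rewrite add0r exprn_ge0.
have x0k : x0 + k%:R <= k.+1%:R by rewrite -natr1 addrC lerD2l.
have [x xk rx] : exists2 x, x0 + k%:R <= x <= k.+1%:R & root S x.
  by apply: poly_ivt => //; rewrite Sk Sk1.
exists x => //; move: xk k1 k2; rewrite -!natr1; lra.
Qed.

(** * Convex hulls and the pyramid polytope *)

Lemma sub_conv_hull (R : realType) (N : nat) (A : set 'rV[R]_N) :
  A `<=` conv_hull A.
Proof.
move=> x Ax; exists 1%N, (fun=> 1), (fun=> x); split => //.
- by rewrite big_ord1.
- by rewrite big_ord1 scale1r.
Qed.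

(** Split off one point [v i] of positive weight: either it carries all the weight, or [x] lies
    strictly between [v i] and the renormalised rest [y], and extremality gives [v i = x]. *)
Lemma vertices_conv_hull (R : realType) (N : nat) (A : set 'rV[R]_N) :
  vertices (conv_hull A) `<=` A.
Proof.
move=> x [[k [a [v [a0 a1 Av xE]]]] xext].
have [i ai] : exists i, 0 < a i.
  apply: contrapT => na; suff : \sum_(i < k) a i = 0 by rewrite a1 => /eqP; rewrite oner_eq0.
  rewrite big1// => i _; apply/eqP; rewrite eq_le a0 andbT leNgt.
  by apply/negP => ai; apply: na; exists i.
suff -> : x = v i by [].
have a1' : a i + \sum_(j < k | j != i) a j = 1 by rewrite -a1 [RHS](bigD1 i).
have xE' : x = a i *: v i + \sum_(j < k | j != i) a j *: v j by rewrite xE (bigD1 i).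
set s := \sum_(j < k | j != i) a j in a1'.
have s0 : 0 <= s by rewrite sumr_ge0.
have [s_eq0|s_neq0] := eqVneq s 0.
  have /psumr_eq0P aj0 : s = 0 by [].
  rewrite xE' big1 ?addr0 => [|j ji]; last by rewrite aj0 ?scale0r// => ? _; exact: a0.
  by rewrite (_ : a i = 1) ?scale1r//; lra.
pose y := \sum_(j < k) (if j == i then 0 else a j / s) *: v j.
have Py : conv_hull A y.
  exists k, (fun j => if j == i then 0 else a j / s), v; split => //.
    by move=> j; case: ifP => // _; rewrite divr_ge0.
  rewrite (bigD1 i)//= eqxx add0r (eq_bigr (fun j => a j / s)).
    by rewrite -mulr_suml -/s divff.
  by move=> j /negbTE ->.
have xy : x = a i *: v i + (1 - a i) *: y.
  rewrite xE' (_ : 1 - a i = s); last by lra.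
  congr (_ + _); rewrite /y [in RHS](bigD1 i)//= eqxx scale0r add0r scaler_sumr.
  apply: eq_bigr => j /negbTE ->; rewrite scalerA; congr (_ *: _).
  by rewrite mulrCA divff ?mulr1.
have [] := xext (v i) y (a i) (sub_conv_hull _ _ _ _ (Av i)) Py _ xy => //.
rewrite ai /=; lra.
Qed.

(* The order polytope of [n + 1] elements of which those of index [1, ..., m]
   lie below the one of index [0]: the product of a pyramid over the
   [m]-dimensional cube with an [n - m]-dimensional cube. *)
Definition cube_pyramid_vertices (R : realType) (n m : nat) : set 'rV[R]_n.+1 :=
  [set v | (forall j, v 0 j = 0 \/ v 0 j = 1) /\
           forall j : 'I_n.+1, (j <= m)%N -> v 0 j <= v 0 ord0].

Definition cube_pyramid (R : realType) (n m : nat) : set 'rV[R]_n.+1 :=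
  conv_hull (cube_pyramid_vertices R n m).

Lemma cube_pyramid_01 (R : realType) (n m : nat) :
  is_01_polytope (cube_pyramid R n m).
Proof.
split; last by move=> x /vertices_conv_hull[].
exists (cube_pyramid_vertices R n m); split => //; last first.
  by exists 0; split => *; rewrite !mxE//; left.
pose g (f : {ffun 'I_n.+1 -> bool}) : 'rV[R]_n.+1 := \row_j (f j)%:R.
apply: (@sub_finite_set _ _ (g @` setT)); last exact/finite_image/finite_finset.
move=> v [v01 _]; exists [ffun j => v 0 j == 1] => //.
apply/rowP => j; rewrite !mxE ffunE.
by have [->|->] := v01 j; rewrite ?eqxx// eq_sym oner_eq0.
Qed.

Lemma cube_pyramid_dim (R : realType) (n m : nat) :
  has_dim (cube_pyramid R n m) n.+1.
Proof.
exists 0, fullv; split; first by rewrite dimvf /dim /= mul1n.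
apply/seteqP; split => x _; first by exists x; rewrite ?add0r//= memvf.
(* [e 0] and the [e 0 + e i] are vertices, and form a basis *)
pose e (i : 'I_n.+1) : 'rV[R]_n.+1 := \row_j ((j == ord0) || (j == i))%:R.
have eP i : cube_pyramid R n m (e i).
  apply: sub_conv_hull; split => [j|j _]; rewrite !mxE.
    by case: (_ || _); [right|left].
  by rewrite eqxx ler_nat; case: (_ || _).
have zP : cube_pyramid R n m 0.
  by apply: sub_conv_hull; split => *; rewrite !mxE//; left.
(* Every [e i] has coordinate 1 at [ord0], so the coefficient of [e ord0] must make up for all the
   others. *)
pose c (i : 'I_n.+1) := if i == ord0 then x 0 ord0 - \sum_(j < n) x 0 (lift ord0 j)
                        else x 0 i.
(* The extra point 0 takes the weight that brings the total to 1. *)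
exists n.+2, (fun i => if unlift ord0 i is Some j then c j else 1 - \sum_j c j).
exists (fun i => if unlift ord0 i is Some j then e j else 0); split.
- rewrite big_ord_recl unlift_none.
  by rewrite [X in _ + X](eq_bigr c) ?subrK// => i _; rewrite liftK.
- by move=> i; case: unliftP.
- rewrite big_ord_recl unlift_none scaler0 add0r.
  rewrite (eq_bigr (fun i => c i *: e i)); last by move=> i _; rewrite liftK.
  apply/rowP => j; rewrite summxE big_ord_recl.
  have nl (i : 'I_n) : (lift ord0 i == ord0) = false by [].
  rewrite (eq_bigr (fun i : 'I_n => x 0 (lift ord0 i) *
      ((j == ord0) || (j == lift ord0 i))%:R)); last by move=> i _; rewrite !mxE /c nl.
  rewrite !mxE /c eqxx orbb.
  case: (unliftP ord0 j) => [i ->|->].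
    rewrite nl mulr0 add0r (bigD1 i)//= eqxx mulr1 big1 ?addr0// => k ki.
    by rewrite (inj_eq lift_inj) eq_sym (negbTE ki) mulr0.
  by rewrite eqxx /= -mulr_suml !mulr1 subrK.
Qed.

(** * Lattice points of the dilates and the Ehrhart polynomial *)

Lemma sum_ltn_ord (N a : nat) : (\sum_(t < N) (t < a) = minn a N)%N.
Proof.
elim: N => [|N IH]; first by rewrite big_ord0 minn0.
by rewrite big_ord_recr /= IH; case: ltnP => ?; lia.
Qed.

(** Order-preserving maps from the poset to a chain of [N.+1] elements, which encode the lattice
    points of the [N]-th dilate of its order polytope. *)
Definition pyramid_maps (n m N : nat) : {set {ffun 'I_n.+1 -> 'I_N.+1}} :=
  [set f : {ffun 'I_n.+1 -> 'I_N.+1} |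
    [forall j : 'I_n.+1, (j <= m)%N ==> (f j <= f ord0)%N]].

Lemma dilate_cube_pyramid_int (R : realType) (n m N : nat) :
  dilate N (cube_pyramid R n m) `&` @int_points R n.+1 =
  [set \row_j (f j : nat)%:R | f in [set` pyramid_maps n m N]].
Proof.
apply/seteqP; split => x.
- move=> [[y [k [a [v [a0 a1 Av ->]]]] <-]] xint.
  set y' := \sum_(i < k) _ in xint *.
  (* The inequalities defining the vertex set are linear, so they pass to convex combinations. *)
  have yE j : y' 0 j = \sum_(i < k) a i * v i 0 j.
    by rewrite summxE; apply: eq_bigr => i _; rewrite mxE.
  have y0 j : 0 <= y' 0 j.
    rewrite yE sumr_ge0// => i _; rewrite mulr_ge0//.
    by have [/(_ j)[]-> _] := Av i.
  have y1 j : y' 0 j <= 1.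
    rewrite yE -a1 ler_sum// => i _; rewrite ler_piMr//.
    by have [/(_ j)[]-> _] := Av i.
  have ym (j : 'I_n.+1) : (j <= m)%N -> y' 0 j <= y' 0 ord0.
    move=> jm; rewrite !yE ler_sum// => i _; rewrite ler_wpM2l//.
    by have [_] := Av i; apply.
  pose z j := Num.trunc ((N%:R *: y') 0 j).
  have xE j : (z j)%:R = N%:R * y' 0 j.
    rewrite /z truncnK ?mxE// natrEint; have := xint j; rewrite mxE => -> /=.
    by rewrite mulr_ge0.
  have xN j : (z j < N.+1)%N.
    by rewrite ltnS -(ler_nat R) xE ler_piMr.
  exists [ffun j => Ordinal (xN j)].
    rewrite /= inE; apply/forallP => j; apply/implyP => jm; rewrite !ffunE /=.
    by rewrite -(ler_nat R) !xE ler_wpM2l// ym.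
  by apply/rowP => j; rewrite mxE ffunE /= xE mxE.
- move=> [f]; rewrite /= inE => /forallP fm <-; split; last first.
    by move=> j; rewrite mxE natr_int.
  (* The averaging below divides by [N], so the dilate by 0 is treated apart. *)
  have [N0|N0] := posnP N.
    exists 0.
      by apply: sub_conv_hull; split => *; rewrite !mxE//; left.
    apply/rowP => j; rewrite !mxE mulr0.
    by have fj0 : f j = 0%N :> nat; [have := ltn_ord (f j); lia|rewrite fj0].
  have NR : N%:R != 0 :> R by rewrite pnatr_eq0 -lt0n.
  exists (N%:R^-1 *: \row_j (f j : nat)%:R); last by rewrite scalerA divff// scale1r.
  (* an integer point is the average of the indicators of its superlevel sets *)
  exists N, (fun=> N%:R^-1), (fun t => \row_j ((t < f j)%N : nat)%:R); split.
  + by move=> _; rewrite invr_ge0.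
  + by rewrite sumr_const card_ord -[LHS]mulr_natl divff.
  + move=> t; split => [j|j jm]; rewrite !mxE.
      by case: (t < f j)%N; [right|left].
    rewrite ler_nat; have := implyP (fm j) jm.
    by case: (ltnP t (f j)) => // tj /(leq_trans tj) ->.
  + rewrite -scaler_sumr; congr (_ *: _); apply/rowP => j.
    rewrite summxE mxE.
    under eq_bigr do rewrite mxE.
    rewrite -natr_sum sum_ltn_ord; congr (_%:R).
    by have := ltn_ord (f j); lia.
Qed.

(** Once the value [h] at [ord0] is fixed, the other values are independent: [m] of them have [h.+1]
    choices each, and [n - m] have [N.+1]. *)
Lemma card_pyramid_maps (n m N : nat) : (m <= n)%N ->
  #|pyramid_maps n m N| = ((\sum_(h < N.+1) h.+1 ^ m) * N.+1 ^ (n - m))%N.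
Proof.
move=> mn; rewrite -sum1_card (partition_big (fun f : {ffun 'I_n.+1 -> 'I_N.+1} => f ord0) xpredT)//=.
rewrite big_distrl /=; apply: eq_bigr => h _; rewrite sum1_card.
pose F (j : 'I_n.+1) : pred 'I_N.+1 :=
  fun i => if j == ord0 then i == h else (j <= m)%N ==> (i <= h)%N.
transitivity #|family F|.
  apply: eq_card => f; rewrite unfold_in /= [_ \in pyramid_maps _ _ _]inE; apply/andP/familyP.
    move=> [/forallP fm /eqP f0] j; rewrite /in_mem /= /F.
    by case: eqP => [->|_]; [rewrite f0|rewrite -f0 fm].
  move=> fF; have /eqP f0 : f ord0 == h by have := fF ord0.
  split; last exact/eqP.
  apply/forallP => j; rewrite f0; have := fF j; rewrite /in_mem /= /F.
  by case: eqP => // -> _; rewrite f0 leqnn.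
rewrite card_family foldrE big_map big_enum /= big_ord_recl.
have -> : #|F ord0| = 1%N by rewrite -(card1 h); apply: eq_card.
(* [i] stands for the element of index [i + 1], so [i < m] expresses that it lies below [ord0]. *)
rewrite mul1n (eq_bigr (fun i : 'I_n => if (i < m)%N then h.+1 else N.+1)).
  rewrite -(big_mkord xpredT (fun i => if (i < m)%N then h.+1 else N.+1)).
  rewrite (big_cat_nat (leq0n m) mn) /=; congr (_ * _)%N.
    rewrite big_nat (eq_bigr (fun=> h.+1)) => [|i /andP[_ ->]//].
    by rewrite -big_nat prod_nat_const_nat subn0.
  rewrite big_nat (eq_bigr (fun=> N.+1)) => [|i /andP[mi _]].
    by rewrite -big_nat prod_nat_const_nat.
  by rewrite ltnNge mi.
move=> i _.
have -> : #|F (lift ord0 i)| = (\sum_(t < N.+1) (t < if (i < m)%N then h.+1 else N.+1))%N.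
  rewrite -sum1_card big_mkcond /=; apply: eq_bigr => t _.
  rewrite /in_mem /= /F /= /bump /= add1n.
  by case: (ltnP i m) => im; rewrite ?ltn_ord ?ltnS //=; case: leqP.
rewrite sum_ltn_ord; have := ltn_ord h; case: ifP; lia.
Qed.

(** The sum of [h ^ m] for [h] from 1 to [N + 1] telescopes to [S.[N + 2] - S.[1]]. *)
Lemma cube_pyramid_ehrhart (R : realType) (n m : nat) (S : {poly R}) :
  (m <= n)%N -> S \Po ('X + 1) - S = 'X^m ->
  is_ehrhart_poly (cube_pyramid R n m)
    ((S \Po ('X + 2%:P) - S.[1]%:P) * ('X + 1) ^+ (n - m)).
Proof.
move=> mn HS N; exists #|pyramid_maps n m N|; split.
  rewrite dilate_cube_pyramid_int.
  have -> : [set` pyramid_maps n m N] = enum_val @` [set: 'I_#|pyramid_maps n m N|].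
    apply/seteqP; split => f /=.
      by move=> fP; exists (enum_rank_in fP f) => //; rewrite enum_rankK_in.
    by move=> [i _ <-]; exact: enum_valP.
  rewrite image_comp.
  apply: card_eq_trans (inj_card_eq _) _.
    move=> i j _ _ /= /rowP fij; apply: enum_val_inj; apply/ffunP => l.
    by have := fij l; rewrite !mxE => /eqP; rewrite eqr_nat => /eqP/val_inj.
  by rewrite card_eq_sym card_II.
rewrite card_pyramid_maps// natrM natrX natr_sum.
rewrite hornerM horner_exp !hornerD horner_comp hornerN !hornerC hornerD hornerX hornerC.
rewrite natr1; congr (_ * _).
have -> : N%:R + 2 = 1 + N.+1%:R :> R by rewrite -natr1; ring.
rewrite (horner_addn_power_sum _ _ _ _ _ HS) addrC addKr.
by apply: eq_bigr => i _; rewrite natrX -natr1 addrC.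
Qed.

(** * Roots of the Ehrhart polynomials and their asymptotics *)

(** The bound 5 collects the width 2 of the interval locating the zero of [S], the shift by 2 in
    [S.[x + 2]], and at most 1 for rounding [n] down to an even number. *)
Lemma cube_pyramid_ehrhart_root (R : realType) (n : nat) :
  exists x : R, (exists p, is_ehrhart_poly (cube_pyramid R n n./2.*2) p /\ root p x) /\
    `|x - 1 / (2 * pi * expR 1) * n.+1%:R| <= 5.
Proof.
set M := n./2; set c := 1 / _.
have nM : (M.*2 <= n <= (M.*2).+1)%N by have := odd_double_half n; rewrite -/M; lia.
have [Mn nM1] := andP nM.
have [S [HS S0]] := power_sum_poly_exists R M.*2.
have PE := cube_pyramid_ehrhart _ _ _ S Mn HS.
set p := _ * _ in PE.
have w1 : 1 <= 2 * pi * expR 1 :> R.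
  have := @pi_ge2 R; have := @expR_ge1Dx R 1.
  by move: pi (expR 1) => a b; nra.
have c0 : 0 <= c by rewrite divr_ge0// (le_trans ler01).
have c1 : c <= 1 by rewrite ler_pdivrMr ?mul1r// (lt_le_trans ltr01).
have cn : c * (M.*2).+1%:R <= c * n.+1%:R <= c * (M.*2).+1%:R + 1.
  rewrite ler_wpM2l ?ler_nat//=.
  apply: (@le_trans _ _ (c * (M.*2).+2%:R)); first by rewrite ler_wpM2l ?ler_nat.
  by rewrite -[(M.*2).+2%:R]natr1 mulrDr mulr1 lerD2l.
(* The root -1 serves when [M = 0] or [c * D < 1], with [D = M.*2 + 1]: then [c * n.+1%:R] is at
   most 2. *)
have pneg1 : root p (-1).
  rewrite /root /p hornerM !hornerD horner_comp hornerN !hornerC hornerD hornerX hornerC.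
  by rewrite (_ : -1 + 2 = 1) ?subrr ?mul0r//; ring.
have [M0|M0] := posnP M.
  exists (-1); split; first by exists p.
  move: cn; rewrite M0 mulr1 => cn; rewrite ler_norml; lra.
have [cD|cD] := lerP 1 (c * (M.*2).+1%:R); last first.
  exists (-1); split; first by exists p.
  rewrite ler_norml; have : 0 <= c * (M.*2).+1%:R by rewrite mulr_ge0.
  lra.
have [y ry yb] := power_sum_root _ _ _ c M0 HS S0 erefl cD.
exists (y - 2); split; last by rewrite ler_norml; lra.
exists p; split => //.
rewrite /root /p hornerM !hornerD horner_comp hornerN !hornerC hornerD hornerX hornerC.
(* For positive [M], [S.[1] = S.[0] = 0], so the constant subtracted in [p] vanishes. *)
have := horner_addn_power_sum _ _ _ 1 0 HS.
rewrite S0 big_ord1 addr0 expr0n double_eq0 gtn_eqF// !add0r => ->.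
by rewrite subrK (eqP ry) subrr mul0r.
Qed.

Theorem theorem1p3 (R : realType) :
  (forall t : R, 0 < t ->
     exists (N : nat) (P : set 'rV[R]_N) (p : {poly R}) (x : R),
       [/\ is_lattice_polytope P, is_ehrhart_poly P p, root p x & t < x]) /\
  (exists (N : nat -> nat) (P : forall d : nat, set 'rV[R]_(N d))
          (alpha : nat -> R),
     (forall d : nat, (0 < d)%N ->
        [/\ is_01_polytope (P d), has_dim (P d) d
          & exists p : {poly R},
              is_ehrhart_poly (P d) p /\ root p (alpha d)]) /\
     alpha d / d%:R @[d --> \oo] --> 1 / (2 * pi * expR 1)).
Proof.
set c := 1 / _.
have c0 : 0 < c by rewrite divr_gt0// mulr_gt0 ?expR_gt0// mulr_gt0// pi_gt0.
split.
  move=> t t0.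
  (* This makes [c * n.+1%:R] exceed [t] by more than the error bound 5. *)
  have [n nP] : exists n : nat, (t + 5) / c < n.+1%:R.
    have t5 : 0 <= (t + 5) / c by rewrite divr_ge0 ?ltW//; lra.
    by have /andP[_] := truncn_itv t5; exists (Num.trunc ((t + 5) / c)).
  have [x [[p [pE px]]]] := cube_pyramid_ehrhart_root R n.
  rewrite -/c ler_norml => xc.
  exists n.+1, (cube_pyramid R n n./2.*2), p, x; split => //.
    have [Ppoly P01] := cube_pyramid_01 R n n./2.*2.
    by split => // v /P01 v01 j; have [->|->] := v01 j.
  by move: nP; rewrite ltr_pdivrMr// mulrC; lra.
have /choice[alpha alphaP] := cube_pyramid_ehrhart_root R.
(* The ambient dimension is [d] for positive [d]; at [d = 0] it is the irrelevant value 1. *)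
exists (fun d => d.-1.+1), (fun d => cube_pyramid R d.-1 d.-1./2.*2), (alpha \o predn).
split.
  case=> // d _; split; [exact: cube_pyramid_01|exact: cube_pyramid_dim|].
  exact: (alphaP d).1.
(* With [d = n + 1], the error 5 divided by [d] is [5 * harmonic n]. *)
rewrite -(cvg_shiftS (fun d => (alpha \o predn) d / d%:R)) /=.
have h0 : 5 * harmonic n @[n --> \oo] --> (0 : R).
  by rewrite -[X in _ --> X](mulr0 5); apply: cvgMr; exact: cvg_harmonic.
apply: (@squeeze_cvgr _ _ _ _ (fun n => c - 5 * harmonic n) (fun n => c + 5 * harmonic n)).
- apply: nearW => n; have := (alphaP n).2; rewrite -/c ler_norml => an.
  rewrite /harmonic /= ler_pdivlMr// ler_pdivrMr// mulrBl (mulrDl c).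
  rewrite divfK ?pnatr_eq0//; lra.
- by rewrite -[X in _ --> X](subr0 c); apply: cvgB => //; exact: cvg_cst.
- by rewrite -[X in _ --> X](addr0 c); apply: cvgD => //; exact: cvg_cst.
Qed.
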